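(* Let $\mathcal{F}_{+1}$ be $\operatorname{dom}(S^* )$ equipped with the graph inner product $\langle f,g\rangle_{+\mathcal{F}}:=\langle S^*f,S^*g\rangle+\langle f,g\rangle$. Then $\mathcal{F}_{+1}$ is a Hilbert space of entire functions with reproducing kernel, isometrically invariant under the conjugation $f(z)\mapsto f^\#(z):=\overline{f(\overline z)}$, and invariant under the mapping $f(z)\mapsto\frac{z-\overline w}{z-w}f(z)$ whenever $w\in\mathbb{C}$ is a non-real zero of $f(z)$.
   Context: Inner products are conjugate linear in the left argument. For an entire function $f$, $f^\#(z):=\overline{f(\overline z)}$. A Hilbert space of entire functions is a de Branges (dB) space if it has a reproducing kernel (point evaluations are continuous) and is isometrically invariant under $f\mapsto f^\#$ and under $f(z)\mapsto \frac{z-\overline w}{z-w}f(z)$ whenever $w$ is a non-real zero of $f$. The Hermite-Biehler class consists of entire $e$ with $|e(z)|>|e(\overline z)|$ for all $z$ with $\operatorname{Im} z>0$; for such $e$, $\mathcal{B}(e)$ is the space of entire $f$ with $f/e,\,f^\#/e\in H^2(\mathbb{C}_+)$ (Hardy space of the upper half plane), with inner product $\langle f,g\rangle=\int_{\mathbb{R}}\frac{\overline{f(x)}g(x)}{|e(x)|^2}dx$. Every nonzero dB space equals some $\mathcal{B}(e)$ isometrically. Fix a nonzero dB space $\mathcal{B}=\mathcal{B}(e)$ with $e$ in the Hermite-Biehler class and without real zeros (standing assumption). $S$ is the operator of multiplication by the independent variable on its maximal domain in $\mathcal{B}$; it is assumed throughout that $\operatorname{dom}(S)$ is dense. $S^*$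 is its adjoint in $\mathcal{B}$. *)

(* Defs.v *)
From HB Require Import structures.
From mathcomp Require Import all_boot all_order all_algebra.
From mathcomp Require Import complex.
From mathcomp Require Import all_classical all_reals all_analysis.
Import Order.TTheory GRing.Theory Num.Theory.
Import numFieldNormedType.Exports.
Import ComplexField.Normc.

Set Implicit Arguments.
Unset Strict Implicit.
Unset Printing Implicit Defensive.

Local Open Scope classical_set_scope.
Local Open Scope ring_scope.
Local Open Scope complex_scope.

Section EntireFunctions.
Context {R : realType}.
Local Notation C := R[i].
Local Notation mu := (@lebesgue_measure R).
Implicit Types (f g F e : C -> C) (z w : C).

(* R[i] carries its norm topology, and the structure of a normed module over
   itself, under the alias R[i]^o. *)
Definition differentiable_at f z : Prop := derivable (f : C^o -> C^o) z 1.

Definition entire f : Prop := forall z, differentiable_at f z.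

Definition sharp f : C -> C := fun z => (f z^*)^*.

(* The function (z - w^* ) / (z - w) * f z for a zero w of f; the value at w is
   the one that removes the singularity. *)
Definition swap_zero w f : C -> C := fun z =>
  if z == w then (w - w^*) * 'D_1 (f : C^o -> C^o) w
  else (z - w^*) / (z - w) * f z.

Definition hermite_biehler e : Prop :=
  entire e /\ (forall z, 0 < complex.Im z -> `|e z^*| < `|e z|).

(* The Hardy space of the upper half plane; only the values of F on the open
   upper half plane matter. *)
Definition hardy2 F : Prop :=
  (forall z, 0 < complex.Im z -> differentiable_at F z) /\
  (exists M : R, forall y : R, 0 < y ->
     (\int[mu]_x ((normc (F (x +i* y)) ^+ 2)%:E) <= M%:E)%E).

Definition Cintegral (h : R -> C) : C :=
  (\int[mu]_x complex.Re (h x)) +i* (\int[mu]_x complex.Im (h x)).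

(* A space of functions with an inner product, as raw data; the values of
   [inner] outside the carrier are irrelevant. *)
Record fspace := FSpace {
  carrier : set (C -> C);
  inner : (C -> C) -> (C -> C) -> C }.

Definition fnorm (H : fspace) f : R := Num.sqrt (complex.Re (inner H f f)).

Record hilbert_of_entire (H : fspace) : Prop := HilbertOfEntire {
  hilbert_entire : forall f, carrier H f -> entire f;
  hilbert_0 : carrier H (fun=> 0);
  hilbert_comb : forall (a : C) f g, carrier H f -> carrier H g ->
    carrier H (fun z => a * f z + g z);
  inner_comb : forall (a : C) f g h,
    carrier H f -> carrier H g -> carrier H h ->
    inner H h (fun z => a * f z + g z) = a * inner H h f + inner H h g;
  inner_conj : forall f g, carrier H f -> carrier H g ->
    inner H f g = (inner H g f)^*;
  inner_ge0 : forall f, carrier H f -> 0 <= inner H f f;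
  inner_eq0 : forall f, carrier H f -> inner H f f = 0 -> f = (fun=> 0);
  hilbert_complete : forall u : nat -> C -> C,
    (forall n, carrier H (u n)) ->
    (forall eps : R, 0 < eps -> exists N, forall m n,
       (N <= m)%N -> (N <= n)%N -> fnorm H (fun z => u m z - u n z) < eps) ->
    exists2 f, carrier H f &
      fnorm H (fun z => u n z - f z) @[n --> \oo] --> (0 : R) }.

Definition has_reproducing_kernel (H : fspace) : Prop :=
  exists K : C -> C -> C, forall w,
    carrier H (K w) /\ (forall f, carrier H f -> f w = inner H (K w) f).

Definition sharp_isometric (H : fspace) : Prop :=
  forall f, carrier H f ->
    carrier H (sharp f) /\ fnorm H (sharp f) = fnorm H f.

Definition swap_zero_invariant (H : fspace) : Prop :=
  forall f w, carrier H f -> complex.Im w != 0 -> f w = 0 ->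
    carrier H (swap_zero w f).

Definition swap_zero_isometric (H : fspace) : Prop :=
  forall f w, carrier H f -> complex.Im w != 0 -> f w = 0 ->
    carrier H (swap_zero w f) /\ fnorm H (swap_zero w f) = fnorm H f.

Definition dB_space (H : fspace) : Prop :=
  [/\ hilbert_of_entire H, has_reproducing_kernel H,
      sharp_isometric H & swap_zero_isometric H].

Definition nonzero_space (H : fspace) : Prop :=
  exists2 f, carrier H f & f <> (fun=> 0).

Definition deBranges e : fspace := FSpace
  [set f | [/\ entire f, hardy2 (fun z => f z / e z)
             & hardy2 (fun z => sharp f z / e z)]]
  (fun f g => Cintegral (fun x => (f x%:C)^* * g x%:C / `|e x%:C| ^+ 2)).

Definition isometrically_equal (H1 H2 : fspace) : Prop :=
  carrier H1 = carrier H2 /\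
  (forall f g, carrier H1 f -> carrier H1 g -> inner H1 f g = inner H2 f g).

Definition dense_in (H : fspace) (D : set (C -> C)) : Prop :=
  forall f, carrier H f -> forall eps : R, 0 < eps ->
    exists2 g, D g & fnorm H (fun z => f z - g z) < eps.

Record operator := Operator {
  dom : set (C -> C);
  app : (C -> C) -> (C -> C) }.

Definition mulz (H : fspace) : operator := Operator
  [set f | carrier H f /\ carrier H (fun z => z * f z)]
  (fun f z => z * f z).

Definition adjoint_rel (H : fspace) (T : operator) f h : Prop :=
  [/\ carrier H f, carrier H h &
      forall g, dom T g -> inner H (app T g) f = inner H g h].

(* When dom T is dense, the h related to f is unique, so [xget] merely
   extracts it. *)
Definition adjoint (H : fspace) (T : operator) : operator := Operator
  [set f | exists h, adjoint_rel H T f h]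
  (fun f => xget (fun=> 0) [set h | adjoint_rel H T f h]).

Definition graph_space (H : fspace) (T : operator) : fspace := FSpace
  (dom T)
  (fun f g => inner H (app T f) (app T g) + inner H f g).

End EntireFunctions.

Arguments fspace : clear implicits.
Arguments operator : clear implicits.

(* Main.v *)
Require Import Defs.
From mathcomp Require Import all_boot all_order all_algebra.
From mathcomp Require Import complex.
From mathcomp Require Import all_classical all_reals all_analysis.
From mathcomp Require Import ring lra.
Import Order.TTheory GRing.Theory Num.Theory.
Import numFieldNormedType.Exports.
Import ComplexField.Normc.

(** The adjoint S* of a densely defined operator is a closed operator, so its
    domain is complete for the graph norm; the graph norm dominates the norm of
    the ambient space, so point evaluations remain bounded, and the Riesz
    representation theorem, applied in the graph space, produces the
    reproducing kernel. This part ([graph_hilbert],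
    [graph_reproducing_kernel]) holds for every densely defined operator of a
    Hilbert space of entire functions.

    The conjugation # is antiunitary (by polarization, [inner_sharp]) and
    commutes with the operator S of multiplication by z, hence it commutes
    with S* ([adjoint_rel_sharp]); being isometric for both f and S* f it is isometric
    for the graph norm.

    Finally let w be a non-real zero of f in dom(S* ). Then
    (z - w^* ) / (z - w) * f = f + (w - w^* ) * q with q = f / (z - w). The left
    side is in the de Branges space by its invariance under this map, hence so
    is q, and z * q = f + w * q as well: q is in dom(S)
    ([swap_zero_sub_dom]). The inner product is an integral against a weight
    on the real line, where z is real, so S is symmetric and
    dom(S) is contained in dom(S* ) ([mulz_sub_adjoint]). Thus the swapped
    function is a linear combination of two elements of dom(S* ). *)

Set Implicit Arguments.
Unset Strict Implicit.
Unset Printing Implicit Defensive.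

Local Open Scope classical_set_scope.
Local Open Scope ring_scope.
Local Open Scope complex_scope.

(** * Modulus of complex numbers *)

Section ComplexModulus.
Context {R : realType}.
Implicit Types x y : R[i].

Lemma normcD_le x y : normc (x + y) <= normc x + normc y.
Proof. by rewrite -lecR rmorphD; exact: (ler_normD x y). Qed.

Lemma Re_le_normc x : complex.Re x <= normc x.
Proof.
case: x => a b /=; apply: (le_trans (ler_norm a)).
by rewrite -sqrtr_sqr ler_sqrt ?lerDl ?addr_ge0 ?sqr_ge0.
Qed.

Lemma mul_conjc x : x * x^* = (normc x ^+ 2)%:C.
Proof.
case: x => a b; rewrite /= sqr_sqrtr ?addr_ge0 ?sqr_ge0//.
apply/eqP; rewrite eq_complex /= mulrN opprK -!expr2.
by rewrite [b * a]mulrC mulrN addNr !eqxx.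
Qed.

Lemma normc_conj x : normc x^* = normc x.
Proof. by case: x => u v /=; rewrite sqrrN. Qed.

Lemma normc_real_ge0 (r : R) : 0 <= r -> normc r%:C = r.
Proof. by move=> r0; rewrite /= expr0n addr0 sqrtr_sqr ger0_norm. Qed.

Lemma eq0_normc_cvg0 x (a : nat -> R) :
  (forall n, normc x <= a n) -> a n @[n --> \oo] --> (0 : R) -> x = 0.
Proof.
move=> xa a0; apply/eqP; rewrite -[_ == _](normr_eq0 x).
have : normc x <= 0.
  rewrite -(cvg_lim _ a0)//; apply: limr_ge; first by apply/cvg_ex; exists 0.
  by apply: nearW.
rewrite -lecR => h; rewrite eq_le; apply/andP; split => //; exact: normr_ge0.
Qed.

(** The discriminant bound in complex form. It yields both the Cauchy-Schwarz
    inequality and the estimate on approximate minimizers in the Riesz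
    theorem. *)
Lemma quadratic_ge0_bound x (n d : R) : 0 <= n -> 0 <= d ->
  (forall a : R[i],
     0 <= normc a ^+ 2 * n ^+ 2 + 2 * complex.Re (a * x) + d ^+ 2) ->
  normc x <= n * d.
Proof.
move=> n0 d0 q; have c0 : 0 <= normc x by rewrite -lecR; exact: (normr_ge0 x).
have {}q (t : R) :
    0 <= t ^+ 2 * normc x ^+ 2 * n ^+ 2 - 2 * t * normc x ^+ 2 + d ^+ 2.
  (* this phase makes a * x a negative real number for t > 0 *)
  have := q (- (t%:C * x^*)); rewrite normcN normcM normc_conj.
  have -> : - (t%:C * x^*) * x = (- (t * normc x ^+ 2))%:C.
    by rewrite rmorphN rmorphM /= -mul_conjc; ring.
  by rewrite /= exprMn expr0n addr0 sqrtr_sqr real_normK ?num_real//; lra.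
rewrite -ler_sqr ?nnegrE ?mulr_ge0// exprMn.
have [n_eq0|n_neq0] := eqVneq n 0.
  move: q; rewrite n_eq0 expr0n /= mul0r => q.
  rewrite leNgt; apply/negP => x_gt0.
  (* as n = 0, the bound is affine in t; at this t it reads 0 <= - d ^ 2 - 2 *)
  have := q ((d ^+ 2 + 1) / normc x ^+ 2).
  by rewrite mulr0 -mulrA divfK ?gt_eqF//; have := sqr_ge0 d; lra.
have n2 : 0 < n ^+ 2 by rewrite exprn_gt0// lt0r n_neq0.
(* t = 1 / n ^ 2 is the minimizer of the real quadratic *)
have := q (n ^- 2); rewrite -(pmulr_rge0 _ n2).
have -> : n ^+ 2 * (n ^- 2 ^+ 2 * normc x ^+ 2 * n ^+ 2 -
  2 * n ^- 2 * normc x ^+ 2 + d ^+ 2) = n ^+ 2 * d ^+ 2 - normc x ^+ 2.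
  by field.
by rewrite subr_ge0.
Qed.
End ComplexModulus.

(** * Hilbert spaces of entire functions and the Riesz theorem *)

Section HilbertSpace.
Context {R : realType} {H : fspace R}.
Hypothesis hH : hilbert_of_entire H.
Local Notation C := R[i].
Implicit Types (f g h u : C -> C) (a : C).

Lemma sub_combE f g : (fun z => f z - g z) = (fun z => -1 * g z + f z).
Proof. by apply/funext => z; ring. Qed.

Lemma carrierB f g : carrier H f -> carrier H g ->
  carrier H (fun z => f z - g z).
Proof. by move=> Hf Hg; rewrite sub_combE; exact: hilbert_comb. Qed.

Lemma carrierZ a f : carrier H f -> carrier H (fun z => a * f z).
Proof.
move=> Hf; suff -> : (fun z => a * f z) = (fun z => a * f z + 0).
  by apply: hilbert_comb => //; exact: hilbert_0.
by apply/funext => z; ring.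
Qed.

Lemma inner_r0 h : carrier H h -> inner H h (fun=> 0) = 0.
Proof.
move=> Hh; have H0 := hilbert_0 hH.
have : inner H h (fun=> 0) = 1 * inner H h (fun=> 0) + inner H h (fun=> 0).
  rewrite -inner_comb//; congr (inner H h _).
  by apply/funext => z; ring.
by rewrite mul1r => /eqP; rewrite eq_sym -subr_eq0 addrK => /eqP.
Qed.

Lemma innerBr h f g : carrier H h -> carrier H f -> carrier H g ->
  inner H h (fun z => f z - g z) = inner H h f - inner H h g.
Proof. by move=> Hh Hf Hg; rewrite sub_combE inner_comb//; ring. Qed.

Lemma inner_combl a f g h : carrier H f -> carrier H g -> carrier H h ->
  inner H (fun z => a * f z + g z) h = a^* * inner H f h + inner H g h.
Proof.
move=> Hf Hg Hh; rewrite (inner_conj hH)//; last exact: hilbert_comb.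
by rewrite inner_comb// rmorphD rmorphM /= -!(inner_conj hH).
Qed.

Lemma innerBl f g h : carrier H f -> carrier H g -> carrier H h ->
  inner H (fun z => f z - g z) h = inner H f h - inner H g h.
Proof.
move=> Hf Hg Hh; rewrite (inner_conj hH)//; last exact: carrierB.
by rewrite innerBr// rmorphB /= -!(inner_conj hH).
Qed.

Lemma fnorm_ge0 f : 0 <= fnorm H f.
Proof. exact: sqrtr_ge0. Qed.

Lemma inner_fnorm f : carrier H f -> inner H f f = (fnorm H f ^+ 2)%:C.
Proof.
move=> /(inner_ge0 hH); rewrite lecE /fnorm.
case: (inner H f f) => x y /= /andP[/eqP-> x0].
by rewrite sqr_sqrtr.
Qed.

Lemma fnorm_eq0 f : carrier H f -> fnorm H f = 0 -> f = (fun=> 0).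
Proof.
by move=> Hf f0; apply: (inner_eq0 hH) => //; rewrite inner_fnorm// f0 expr0n.
Qed.

Lemma fnorm_expand f a g : carrier H f -> carrier H g ->
  fnorm H (fun z => a * g z + f z) ^+ 2 =
  normc a ^+ 2 * fnorm H g ^+ 2 + 2 * complex.Re (a * inner H f g)
  + fnorm H f ^+ 2.
Proof.
move=> Hf Hg; have Hc := hilbert_comb hH a Hg Hf.
apply: complexI; rewrite -inner_fnorm// inner_comb// !inner_combl//.
rewrite !inner_fnorm// (inner_conj hH Hg Hf) !rmorphD /=.
rewrite [(normc a ^+ 2 * _)%:C]rmorphM [(2 * complex.Re _)%:C]rmorphM /=.
rewrite -mul_conjc ReJ_add rmorphM /= rmorph_nat.
by field.
Qed.

Lemma cauchy_schwarz f g : carrier H f -> carrier H g ->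
  normc (inner H f g) <= fnorm H f * fnorm H g.
Proof.
move=> Hf Hg; rewrite mulrC.
apply: quadratic_ge0_bound; rewrite ?fnorm_ge0// => a.
by rewrite -fnorm_expand// sqr_ge0.
Qed.

Lemma orthogonal_dense (D : set (C -> C)) h : D `<=` carrier H ->
  dense_in H D -> carrier H h -> (forall g, D g -> inner H g h = 0) ->
  h = (fun=> 0).
Proof.
move=> DH dD Hh h_orth; apply: fnorm_eq0 => //; apply/eqP.
rewrite eq_le fnorm_ge0 andbT leNgt; apply/negP => h_gt0.
have [g Dg hg] := dD h Hh _ h_gt0; have Hg := DH _ Dg.
have := cauchy_schwarz (carrierB Hh Hg) Hh.
rewrite innerBl// (h_orth g Dg) subr0 inner_fnorm// normc_real_ge0 ?sqr_ge0//.
by rewrite expr2 ler_pM2r// leNgt hg.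
Qed.

Section Riesz.
Variables (L : (C -> C) -> C) (M : R).
Hypothesis L_comb : forall a f g, carrier H f -> carrier H g ->
  L (fun z => a * f z + g z) = a * L f + L g.
Hypothesis L_bounded : forall f, carrier H f -> normc (L f) <= M * fnorm H f.

(** An approximate minimizer u of ||f||^2 - 2 Re (L f), with error d^2: moving
    from u in the direction a * g cannot decrease the functional by more than
    d^2, and this is a quadratic inequality in a. *)
Lemma riesz_approx (d : R) : 0 < d -> exists2 u, carrier H u &
  forall g, carrier H g -> normc (inner H u g - L g) <= fnorm H g * d.
Proof.
move=> d0; pose Phi f := fnorm H f ^+ 2 - 2 * complex.Re (L f).
have Phi_inf : has_inf [set Phi f | f in carrier H].
  split; first by exists (Phi (fun=> 0)), (fun=> 0) => //; exact: hilbert_0.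
  (* ||f||^2 - 2 M ||f|| >= - M^2 by completing the square *)
  exists (- M ^+ 2) => _ [f Hf <-]; rewrite /Phi.
  have := le_trans (Re_le_normc (L f)) (L_bounded Hf).
  by have := sqr_ge0 (fnorm H f - M); rewrite sqrrB; lra.
have [_ [u Hu <-] Phi_u] := inf_adherent (exprn_gt0 2 d0) Phi_inf.
exists u => // g Hg.
apply: quadratic_ge0_bound; rewrite ?fnorm_ge0 ?(ltW d0)// => a.
have Hc := hilbert_comb hH a Hg Hu.
have := ge_inf (proj2 Phi_inf) (imageP Phi Hc); move: Phi_u.
move: (inf _) => m.
rewrite /Phi fnorm_expand// L_comb// mulrBr !raddfD /= raddfN /=.
lra.
Qed.

(** A sequence of approximate representatives u_n of L, with error
    1 / (n + 1), is Cauchy: both <u_m, g> and <u_n, g> are close to L g, and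
    g = u_m - u_n turns this into a bound on ||u_m - u_n||. Its limit
    represents L. *)
Lemma riesz : exists2 k, carrier H k &
  forall f, carrier H f -> L f = inner H k f.
Proof.
have /choice[u u_approx] (n : nat) : exists u, carrier H u /\
    forall g, carrier H g ->
      normc (inner H u g - L g) <= fnorm H g * n.+1%:R^-1.
  have [|v Hv v_approx] := @riesz_approx n.+1%:R^-1; last by exists v.
  by rewrite invr_gt0.
have Hu n : carrier H (u n) := proj1 (u_approx n).
have uB m n : fnorm H (fun z => u m z - u n z) <= m.+1%:R^-1 + n.+1%:R^-1.
  set g := (fun z => _); have Hg : carrier H g by exact: carrierB.
  have [g0|g_gt0] := leP (fnorm H g) 0.
    by rewrite (le_trans g0)// addr_ge0// invr_ge0.
  rewrite -(ler_pM2l g_gt0) -expr2 -[leLHS]normc_real_ge0 ?sqr_ge0//.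
  rewrite -inner_fnorm// {1}/g innerBl// mulrDr.
  have -> : inner H (u m) g - inner H (u n) g =
    (inner H (u m) g - L g) + - (inner H (u n) g - L g) by ring.
  apply: (le_trans (normcD_le _ _)); rewrite normcN lerD//.
    exact: (proj2 (u_approx m)).
  exact: (proj2 (u_approx n)).
have inv_cvg0 : n.+1%:R^-1 @[n --> \oo] --> (0 : R) := cvg_harmonic.
have [k Hk u_k] : exists2 k, carrier H k &
    fnorm H (fun z => u n z - k z) @[n --> \oo] --> (0 : R).
  apply: (hilbert_complete hH) => // eps eps0.
  have e2 : 0 < eps / 2 by lra.
  have /cvgrPdist_lt/(_ _ e2)[N _ N_le] := inv_cvg0.
  have inv_lt n : (N <= n)%N -> n.+1%:R^-1 < eps / 2.
    by move=> /N_le /=; rewrite sub0r normrN ger0_norm ?invr_ge0.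
  exists N => m n /inv_lt m_lt /inv_lt n_lt.
  by apply: (le_lt_trans (uB m n)); rewrite (splitr eps) ltrD.
exists k => // f Hf; apply/eqP; rewrite -subr_eq0; apply/eqP.
apply: (@eq0_normc_cvg0 _ _ (fun n =>
  fnorm H (fun z => u n z - k z) * fnorm H f + fnorm H f * n.+1%:R^-1)).
  move=> n; have -> : L f - inner H k f =
    inner H (fun z => u n z - k z) f + - (inner H (u n) f - L f).
    by rewrite innerBl//; ring.
  apply: (le_trans (normcD_le _ _)); rewrite normcN lerD//.
    by apply: cauchy_schwarz => //; exact: carrierB.
  exact: (proj2 (u_approx n)).
rewrite -[X in _ --> X](_ : 0 * fnorm H f + fnorm H f * 0 = 0); last by ring.
by apply: cvgD; apply: cvgM => //; exact: cvg_cst.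
Qed.
End Riesz.
End HilbertSpace.

(** * The graph space of the adjoint of a densely defined operator *)

Section AdjointGraph.
Context {R : realType} {H : fspace R} {T : operator R}.
Hypothesis hH : hilbert_of_entire H.
Hypothesis T_dom : dom T `<=` carrier H.
Hypothesis T_app : forall g, dom T g -> carrier H (app T g).
Hypothesis T_dense : dense_in H (dom T).
Local Notation C := R[i].
Local Notation T' := (adjoint H T).
Local Notation G := (graph_space H T').
Implicit Types (f g h : C -> C) (a : C).

Lemma adjoint_rel_uniq f h1 h2 :
  adjoint_rel H T f h1 -> adjoint_rel H T f h2 -> h1 = h2.
Proof.
move=> [Hf Hh1 h1P] [_ Hh2 h2P].
have h0 : (fun z => h1 z - h2 z) = (fun=> 0).
  apply: (orthogonal_dense hH T_dom T_dense (carrierB hH Hh1 Hh2)) => g Dg.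
  by rewrite innerBr// -?h1P -?h2P ?subrr//; exact: T_dom.
by apply/funext => z; apply/eqP; rewrite -subr_eq0 (congr1 (@^~ z) h0).
Qed.

Lemma adjoint_relP f : dom T' f -> adjoint_rel H T f (app T' f).
Proof. by move=> fP; exact: (xgetPex (fun=> 0) fP). Qed.

Lemma app_adjointE f h : adjoint_rel H T f h -> app T' f = h.
Proof.
by move=> fh; apply: (adjoint_rel_uniq _ fh); apply: adjoint_relP; exists h.
Qed.

Lemma adjoint_rel_comb a f g hf hg : adjoint_rel H T f hf ->
  adjoint_rel H T g hg ->
  adjoint_rel H T (fun z => a * f z + g z) (fun z => a * hf z + hg z).
Proof.
move=> [Hf Hhf fP] [Hg Hhg gP]; split; [exact: hilbert_comb..|move=> k Dk].
have Hk := T_dom Dk; have HTk := T_app Dk.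
by rewrite !inner_comb// fP// gP.
Qed.

(** Adjoints are closed: both sides of <T g, u n> = <g, v n> are continuous for
    the norm, by Cauchy-Schwarz. *)
Lemma adjoint_rel_closed (u v : nat -> C -> C) f h :
  (forall n, adjoint_rel H T (u n) (v n)) -> carrier H f -> carrier H h ->
  fnorm H (fun z => u n z - f z) @[n --> \oo] --> (0 : R) ->
  fnorm H (fun z => v n z - h z) @[n --> \oo] --> (0 : R) ->
  adjoint_rel H T f h.
Proof.
move=> uv Hf Hh uf vh; split => // g Dg.
have Hg := T_dom Dg; have HTg := T_app Dg.
apply/eqP; rewrite -subr_eq0; apply/eqP.
apply: (@eq0_normc_cvg0 _ _ (fun n =>
  fnorm H g * fnorm H (fun z => v n z - h z)
  + fnorm H (app T g) * fnorm H (fun z => u n z - f z))).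
  move=> n; have [Hu Hv uvP] := uv n.
  have -> : inner H (app T g) f - inner H g h =
      inner H g (fun z => v n z - h z)
      + - inner H (app T g) (fun z => u n z - f z).
    by rewrite !innerBr// uvP//; ring.
  apply: (le_trans (normcD_le _ _)); rewrite normcN.
  by apply: lerD; apply: cauchy_schwarz => //; exact: carrierB.
rewrite -[X in _ --> X](_ : fnorm H g * 0 + fnorm H (app T g) * 0 = 0).
  by apply: cvgD; apply: cvgM => //; exact: cvg_cst.
by rewrite !mulr0 addr0.
Qed.

Lemma app_adjoint_comb a f g : dom T' f -> dom T' g ->
  app T' (fun z => a * f z + g z) = (fun z => a * app T' f z + app T' g z).
Proof.
move=> Df Dg; apply: app_adjointE.
by apply: adjoint_rel_comb; exact: adjoint_relP.
Qed.

Lemma adjoint_dom_comb a f g : dom T' f -> dom T' g ->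
  dom T' (fun z => a * f z + g z).
Proof.
move=> [hf fP] [hg gP]; exists (fun z => a * hf z + hg z).
exact: adjoint_rel_comb.
Qed.

Lemma adjoint_domB f g : dom T' f -> dom T' g -> dom T' (fun z => f z - g z).
Proof. by move=> Df Dg; rewrite sub_combE; exact: adjoint_dom_comb. Qed.

Lemma app_adjointB f g : dom T' f -> dom T' g ->
  app T' (fun z => f z - g z) = (fun z => app T' f z - app T' g z).
Proof. by move=> Df Dg; rewrite !sub_combE app_adjoint_comb. Qed.

Lemma adjoint_dom_carrier f : dom T' f -> carrier H f.
Proof. by move=> [h []]. Qed.

Lemma app_adjoint_carrier f : dom T' f -> carrier H (app T' f).
Proof. by move=> /adjoint_relP[]. Qed.

Lemma graph_fnorm f : dom T' f ->
  fnorm G f = Num.sqrt (fnorm H (app T' f) ^+ 2 + fnorm H f ^+ 2).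
Proof.
move=> Df; rewrite {1}/fnorm /= !inner_fnorm ?raddfD//=.
  exact: adjoint_dom_carrier.
exact: app_adjoint_carrier.
Qed.

Lemma fnorm_le_graph f : dom T' f ->
  fnorm H f <= fnorm G f /\ fnorm H (app T' f) <= fnorm G f.
Proof.
move=> Df; rewrite graph_fnorm//; split.
  rewrite -[leLHS](ger0_norm (fnorm_ge0 f)) -sqrtr_sqr.
  rewrite ler_sqrt ?lerDr ?sqr_ge0//.
  by rewrite addr_ge0 ?sqr_ge0.
rewrite -[leLHS](ger0_norm (fnorm_ge0 _)) -sqrtr_sqr ler_sqrt ?lerDl ?sqr_ge0//.
by rewrite addr_ge0 ?sqr_ge0.
Qed.

Lemma graph_fnorm_le f : dom T' f ->
  fnorm G f <= fnorm H (app T' f) + fnorm H f.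
Proof.
move=> Df; rewrite graph_fnorm//.
have s0 : 0 <= fnorm H (app T' f) + fnorm H f by rewrite addr_ge0 ?fnorm_ge0.
rewrite -[leRHS](ger0_norm s0) -sqrtr_sqr ler_sqrt ?sqr_ge0// sqrrD.
by rewrite lerD2r lerDl mulrn_wge0// mulr_ge0 ?fnorm_ge0.
Qed.

Lemma graph_complete (u : nat -> C -> C) :
  (forall n, carrier G (u n)) ->
  (forall eps : R, 0 < eps -> exists N, forall m n,
     (N <= m)%N -> (N <= n)%N -> fnorm G (fun z => u m z - u n z) < eps) ->
  exists2 f, carrier G f &
    fnorm G (fun z => u n z - f z) @[n --> \oo] --> (0 : R).
Proof.
move=> Du u_cauchy; have Hu n := adjoint_dom_carrier (Du n).
have HTu n := app_adjoint_carrier (Du n).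
have [f Hf uf] : exists2 f, carrier H f &
    fnorm H (fun z => u n z - f z) @[n --> \oo] --> (0 : R).
  apply: (hilbert_complete hH) => // eps /u_cauchy[N uN].
  exists N => m n Nm Nn; apply: (le_lt_trans _ (uN m n Nm Nn)).
  exact: (proj1 (fnorm_le_graph (adjoint_domB (Du m) (Du n)))).
have [h Hh Tuh] : exists2 h, carrier H h &
    fnorm H (fun z => app T' (u n) z - h z) @[n --> \oo] --> (0 : R).
  apply: (hilbert_complete hH) => // eps /u_cauchy[N uN].
  exists N => m n Nm Nn; apply: (le_lt_trans _ (uN m n Nm Nn)).
  rewrite -(app_adjointB (Du m) (Du n)).
  exact: (proj2 (fnorm_le_graph (adjoint_domB (Du m) (Du n)))).
have fh : adjoint_rel H T f h.
  apply: (adjoint_rel_closed _ Hf Hh uf Tuh) => n.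
  exact: adjoint_relP (Du n).
have Df : dom T' f by exists h.
exists f => //.
apply: (@squeeze_cvgr _ _ _ _ (fun=> 0) (fun n =>
  fnorm H (fun z => app T' (u n) z - h z) + fnorm H (fun z => u n z - f z))).
- apply: nearW => n; rewrite fnorm_ge0 /=.
  have := graph_fnorm_le (adjoint_domB (Du n) Df).
  by rewrite (app_adjointB (Du n) Df) (app_adjointE fh).
- exact: cvg_cst.
- by rewrite -[X in _ --> X](addr0 0); exact: cvgD.
Qed.

Lemma graph_hilbert : hilbert_of_entire G.
Proof.
have Hc f : dom T' f -> carrier H f by exact: adjoint_dom_carrier.
have Ha f : dom T' f -> carrier H (app T' f) by exact: app_adjoint_carrier.
have GE f g : inner G f g = inner H (app T' f) (app T' g) + inner H f g by [].
split.
- by move=> f /Hc; exact: hilbert_entire.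
- exists (fun=> 0); split; [exact: hilbert_0..|move=> g Dg].
  by rewrite !inner_r0//; [exact: T_dom|exact: T_app].
- exact: adjoint_dom_comb.
- move=> a f g h Df Dg Dh; rewrite !GE app_adjoint_comb//.
  rewrite !(inner_comb hH); try by [exact: Hc|exact: Ha].
  by ring.
- move=> f g Df Dg; rewrite !GE rmorphD /=.
  by rewrite -!(inner_conj hH) //; by [exact: Hc|exact: Ha].
- move=> f Df; rewrite GE addr_ge0// (inner_ge0 hH)//.
  + exact: Ha.
  + exact: Hc.
- move=> f Df /eqP.
  rewrite GE paddr_eq0; [|exact/(inner_ge0 hH)/Ha|exact/(inner_ge0 hH)/Hc].
  by case/andP=> _ /eqP; apply: (inner_eq0 hH); exact: Hc.
- exact: graph_complete.
Qed.

Lemma graph_reproducing_kernel :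
  has_reproducing_kernel H -> has_reproducing_kernel G.
Proof.
move=> [K KP]; suff /choice[K' K'P] : forall w, exists k, carrier G k /\
    forall f, carrier G f -> f w = inner G k f by exists K'.
move=> w; have [HK Kw] := KP w.
have [|f Df|k Dk kP] := riesz graph_hilbert (L := @^~ w) (M := fnorm H (K w)).
- by [].
- have Hf := adjoint_dom_carrier Df.
  rewrite Kw//; apply: (le_trans (cauchy_schwarz hH HK Hf)).
  by rewrite ler_wpM2l ?fnorm_ge0//; exact: (proj1 (fnorm_le_graph Df)).
- by exists k.
Qed.

End AdjointGraph.

(** * Conjugation *)

Section Conjugation.
Context {R : realType} {H : fspace R}.
Hypothesis hH : hilbert_of_entire H.
Hypothesis H_sharp : sharp_isometric H.
Local Notation C := R[i].
Implicit Types (f g h : C -> C) (a : C).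

Lemma sharpK f : sharp (sharp f) = f.
Proof. by apply/funext => z; rewrite /sharp !conjcK. Qed.

Lemma sharp_comb a f g :
  sharp (fun z => a * f z + g z) = (fun z => a^* * sharp f z + sharp g z).
Proof. by apply/funext => z; rewrite /sharp rmorphD rmorphM. Qed.

(** Polarization. As # is conjugate linear, comparing the norms of a * g + f
    and of its conjugate for a = 1 and a = 'i gives the real and the imaginary
    part. *)
Lemma inner_sharp f g : carrier H f -> carrier H g ->
  inner H (sharp f) (sharp g) = (inner H f g)^*.
Proof.
move=> Hf Hg; have [Hf' nf] := H_sharp Hf; have [Hg' ng] := H_sharp Hg.
have Re_eq a : complex.Re (a^* * inner H (sharp f) (sharp g)) =
    complex.Re (a * inner H f g).
  have [_] := H_sharp (hilbert_comb hH a Hg Hf).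
  move=> /(congr1 (fun x => x ^+ 2)).
  rewrite sharp_comb !fnorm_expand// nf ng normc_conj.
  by move=> /addIr/addrI/mulfI; apply; rewrite pnatr_eq0.
have := Re_eq 1; have := Re_eq 'i; rewrite /= .
case: (inner H f g) => x y; case: (inner H _ _) => x' y' /=.
rewrite oppr0 !mul0r !mul1r mulN1r subr0 opprK !add0r subr0 => -> ->.
by [].
Qed.

End Conjugation.

(** * Multiplication by the independent variable *)

Section MultiplicationOperator.
Context {R : realType} {B : fspace R}.
Hypothesis hB : hilbert_of_entire B.
Local Notation C := R[i].
Local Notation S := (mulz B).
Implicit Types (f g h : C -> C) (w : C).

Lemma adjoint_rel_sharp f h : sharp_isometric B ->
  adjoint_rel B S f h -> adjoint_rel B S (sharp f) (sharp h).
Proof.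
move=> B_sharp [Hf Hh fh].
split; [exact: (proj1 (B_sharp f Hf))|exact: (proj1 (B_sharp h Hh))|].
move=> g [Hg HSg] /=.
have [Hg' _] := B_sharp g Hg; have [HSg' _] := B_sharp _ HSg.
have sharp_S : sharp (fun z => z * g z) = (fun z => z * sharp g z).
  by apply/funext => z; rewrite /sharp rmorphM /= conjcK.
rewrite -[X in inner B X (sharp f)](sharpK (fun z => z * g z)).
rewrite -[X in inner B X (sharp h)](sharpK g) !inner_sharp//.
by rewrite sharp_S fh //; split => //=; rewrite -sharp_S.
Qed.

(** In the integral over the real line the factor x is real, so it can be moved
    from one argument to the other already in the integrand. *)
Lemma mulz_symmetric e f g : isometrically_equal B (deBranges e) ->
  dom S f -> dom S g ->
  inner B (fun z => z * f z) g = inner B f (fun z => z * g z).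
Proof.
move=> [_ B_e] [Hf HSf] [Hg HSg]; rewrite !B_e//=.
congr (Cintegral _); apply/funext => x.
have -> : ((x%:C * f x%:C)^* = x%:C * (f x%:C)^*)%R.
  by rewrite rmorphM; congr (_ * _); exact: conjc_real.
by ring.
Qed.

Lemma mulz_sub_adjoint e f : isometrically_equal B (deBranges e) ->
  dom S f -> adjoint_rel B S f (fun z => z * f z).
Proof.
move=> B_e Sf; have [Hf HSf] := Sf; split => // g Sg.
exact: mulz_symmetric B_e Sg Sf.
Qed.

(** Here q is f / (z - w), with the singularity at the zero w of f removed.
    Defining it by means of [swap_zero] makes its membership in the space
    immediate. *)
Lemma swap_zero_sub_dom f w : swap_zero_isometric B -> carrier B f ->
  complex.Im w != 0 -> f w = 0 ->
  exists2 q, dom S q & swap_zero w f = (fun z => (w - w^*) * q z + f z).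
Proof.
move=> B_swap Hf w_im fw0; have [Hs _] := B_swap f w Hf w_im fw0.
have ww : w - w^* != 0.
  apply: contra w_im => /eqP/(congr1 (@complex.Im R)).
  case: (w) => a b /=; rewrite opprK => b0; apply/eqP; lra.
pose q z := (w - w^*)^-1 * (swap_zero w f z - f z).
have Hq : carrier B q by apply: carrierZ => //; exact: carrierB.
exists q; last by apply/funext => z; rewrite /q mulrA divff// mul1r subrK.
split => //=; suff -> : (fun z => z * q z) = (fun z => w * q z + f z).
  exact: hilbert_comb.
(* away from w this is z / (z - w) = w / (z - w) + 1; at w it is f w = 0 *)
apply/funext => z; rewrite /q /swap_zero; have [->|zw] := eqVneq z w.
  by rewrite fw0 addr0.
have zw0 : z - w != 0 by rewrite subr_eq0.
by field; rewrite zw0 ww.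
Qed.
End MultiplicationOperator.

Theorem theorem3p2 (R : realType) (B : fspace R) (e : R[i] -> R[i])
    (dB_B : dB_space B) (nz_B : nonzero_space B)
    (HB_e : hermite_biehler e) (e_real : forall x : R, e x%:C <> 0)
    (B_e : isometrically_equal B (deBranges e))
    (dense_S : dense_in B (dom (mulz B))) :
  let F1 := graph_space B (adjoint B (mulz B)) in
  [/\ hilbert_of_entire F1, has_reproducing_kernel F1,
      sharp_isometric F1 & swap_zero_invariant F1].
Proof.
have [hB B_kernel B_sharp B_swap] := dB_B.
have S_dom : dom (mulz B) `<=` carrier B by move=> f [].
have S_app f : dom (mulz B) f -> carrier B (app (mulz B) f) by case.
split.
- exact: graph_hilbert.
- exact: graph_reproducing_kernel.
- move=> f Df; have fh := adjoint_relP Df; have [Hf Hh _] := fh.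
  have fh' := adjoint_rel_sharp hB B_sharp fh.
  have Df' : dom (adjoint B (mulz B)) (sharp f) by eexists; exact: fh'.
  split => //; rewrite !graph_fnorm//.
  rewrite (app_adjointE hB S_dom dense_S fh').
  by rewrite (proj2 (B_sharp _ Hf)) (proj2 (B_sharp _ Hh)).
- move=> f w Df w_im fw0.
  have Hf := adjoint_dom_carrier Df.
  have [q Sq ->] := swap_zero_sub_dom hB B_swap Hf w_im fw0.
  apply: adjoint_dom_comb => //; eexists.
  exact: mulz_sub_adjoint B_e Sq.
Qed.
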